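(* Let $(TM,\lambda)$ be an EAP-space. For the symmetric $d$-connection $\widehat D$ the $W$-tensors $\widehat W^a_{b\nu\mu}$ and $\widehat W^\alpha_{\beta bc}$ vanish identically, and the remaining ones are given by: (a) $\widehat W^\alpha_{\beta\nu\mu}=\widehat R^\alpha_{\beta\mu\nu}$, (b) $\widehat W^\alpha_{\beta\nu c}=\frac12\widetilde W^\alpha_{\beta\nu c}$, (c) $\widehat W^a_{b\nu c}=\frac12\widetilde W^a_{b\nu c}$, (d) $\widehat W^a_{bcd}=\widehat S^a_{bdc}$, where $\widetilde W$ denotes the $W$-tensors of the dual $d$-connection $\widetilde D$ and $\widehat R,\widehat S$ are curvature tensors of $\widehat D$.
   Context: Let $M$ be a smooth paracompact $n$-manifold, $TM$ its tangent bundle with induced local coordinates $(x^\mu,y^a)$, and $N=(N^a_\mu(x,y))$ a given nonlinear connection on $TM$. Greek indices denote horizontal and Latin indices vertical components; both run over $1,\dots,n$; repeated indices (including the mesh index $i$) are summed. Put $\dot\partial_a=\partial/\partial y^a$, $\delta_\mu=\partial/\partial x^\mu-N^a_\mu\dot\partial_a$ (adapted frame $(\delta_\mu,\dot\partial_a)$). A $d$-connection is a linear connection $D$ on $TM$ preserving by parallelism the horizontal and the vertical distribution; its coefficients $(\Gamma^\alpha_{\mu\nu},\Gamma^a_{b\nu},C^\alpha_{\mu c},C^a_{bc})$ are defined by $D_{\delta_\nu}\delta_\mu=\Gamma^\alpha_{\mu\nu}\delta_\alpha$, $D_{\delta_\nu}\dot\partial_b=\Gamma^a_{b\nu}\dot\partial_a$,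 $D_{\dot\partial_c}\delta_\mu=C^\alpha_{\mu c}\delta_\alpha$, $D_{\dot\partial_c}\dot\partial_b=C^a_{bc}\dot\partial_a$. Its $h$- and $v$-covariant derivatives are $T^{\alpha a}{}_{\beta b|\mu}=\delta_\mu T^{\alpha a}_{\beta b}+T^{\epsilon a}_{\beta b}\Gamma^\alpha_{\epsilon\mu}+T^{\alpha d}_{\beta b}\Gamma^a_{d\mu}-T^{\alpha a}_{\epsilon b}\Gamma^\epsilon_{\beta\mu}-T^{\alpha a}_{\beta d}\Gamma^d_{b\mu}$, $T^{\alpha a}{}_{\beta b||c}=\dot\partial_cT^{\alpha a}_{\beta b}+T^{\epsilon a}_{\beta b}C^\alpha_{\epsilon c}+T^{\alpha d}_{\beta b}C^a_{dc}-T^{\alpha a}_{\epsilon b}C^\epsilon_{\beta c}-T^{\alpha a}_{\beta d}C^d_{bc}$, similarly for other types. Its curvature $\mathbf R(X,Y)Z=D_XD_YZ-D_YD_XZ-D_{[X,Y]}Z$ has in particular components $\mathbf R(\delta_\mu,\delta_\nu)\delta_\beta=R^\alpha_{\beta\mu\nu}\delta_\alpha$, $\mathbf R(\dot\partial_c,\dot\partial_d)\dot\partial_b=S^a_{bcd}\dot\partial_a$. EAP-space $(TM,\lambda)$: $TM$ with $N$ and $n$ vector fields $\lambda_i=\lambda_i^\alpha\delta_\alpha+\lambda_i^a\dot\partial_a$ ($i=1,\dots,n$) defined globally on $TM$ with linearly independent horizontal parts and linearly independent vertical parts. $(\lambda_{i\alpha})$, $(\lambda_{ia})$ are the inverse matrices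 of $(\lambda_i^\alpha)$, $(\lambda_i^a)$. Canonical $d$-connection: $\Gamma^\alpha_{\mu\nu}=\lambda_i^\alpha\delta_\nu\lambda_{i\mu}$, $\Gamma^a_{b\nu}=\lambda_i^a\delta_\nu\lambda_{ib}$, $C^\alpha_{\mu c}=\lambda_i^\alpha\dot\partial_c\lambda_{i\mu}$, $C^a_{bc}=\lambda_i^a\dot\partial_c\lambda_{ib}$. Dual $d$-connection $\widetilde D$: $\widetilde\Gamma^\alpha_{\mu\nu}=\Gamma^\alpha_{\nu\mu}$, $\widetilde\Gamma^a_{b\mu}=\Gamma^a_{b\mu}$, $\widetilde C^\alpha_{\mu c}=C^\alpha_{\mu c}$, $\widetilde C^a_{bc}=C^a_{cb}$. Symmetric $d$-connection $\widehat D$: $\widehat\Gamma^\alpha_{\mu\nu}=\frac12(\Gamma^\alpha_{\mu\nu}+\Gamma^\alpha_{\nu\mu})$, $\widehat\Gamma^a_{b\mu}=\Gamma^a_{b\mu}$, $\widehat C^\alpha_{\mu c}=C^\alpha_{\mu c}$, $\widehat C^a_{bc}=\frac12(C^a_{bc}+C^a_{cb})$. $W$-tensors of a $d$-connection (with its own covariant derivatives $|$, $||$) are defined by requiring, for every $\lambda=\lambda_i$: $\lambda^\alpha{}_{|\nu|\mu}-\lambda^\alpha{}_{|\mu|\nu}=\lambda^\epsilon W^\alpha_{\epsilon\nu\mu}$; $\lambda^a{}_{|\nu|\mu}-\lambda^a{}_{|\mu|\nu}=\lambda^dW^a_{d\nu\mu}$; $\lambda^\alpha{}_{|\nu||c}-\lambda^\alpha{}_{||c|\nu}=\lambda^\epsilon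 W^\alpha_{\epsilon\nu c}$; $\lambda^a{}_{|\nu||c}-\lambda^a{}_{||c|\nu}=\lambda^dW^a_{d\nu c}$; $\lambda^\alpha{}_{||b||c}-\lambda^\alpha{}_{||c||b}=\lambda^\epsilon W^\alpha_{\epsilon bc}$; $\lambda^a{}_{||c||d}-\lambda^a{}_{||d||c}=\lambda^eW^a_{ecd}$. *)

(* Defs.v *)
From HB Require Import structures.
From mathcomp Require Import all_boot all_order all_algebra.
From mathcomp Require Import all_classical all_reals all_analysis.

Set Implicit Arguments.
Unset Strict Implicit.
Unset Printing Implicit Defensive.

Import Order.TTheory GRing.Theory Num.Theory.
Import numFieldNormedType.Exports.

Local Open Scope classical_set_scope.
Local Open Scope ring_scope.

Definition paracompact (T : topologicalType) : Prop :=
  hausdorff_space T /\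
  forall F : set (set T), (forall A, F A -> open A) ->
    \bigcup_(A in F) A = setT ->
  exists G : set (set T),
    [/\ forall B, G B -> open B,
        \bigcup_(B in G) B = setT,
        forall B, G B -> exists2 A, F A & B `<=` A &
        forall x : T, exists2 V, nbhs x V & finite_set [set B | G B /\ B `&` V !=set0]].

(* On an open set of a finite-dimensional space, continuity of all iterated
   directional derivatives up to order k is the classical C^k condition. *)
Fixpoint is_Ck (R : realType) (V : normedModType R) (k : nat) (U : set V)
    (f : V -> R) : Prop :=
  (forall x, U x -> {for x, continuous f}) /\
  match k with
  | 0%N => True
  | k'.+1 => forall v : V,
      (forall x, U x -> derivable f x v) /\ is_Ck k' U ('D_v f)
  end.

Definition smooth_on (R : realType) (V : normedModType R) (U : set V)
    (f : V -> R) : Prop := forall k, is_Ck k U f.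

Record smoothManifold (R : realType) (n : nat) (M : topologicalType) := {
  chart_index : Type;
  dom : chart_index -> set M;
  chart : chart_index -> M -> 'rV[R]_n;
  chart_inv : chart_index -> 'rV[R]_n -> M;
  manifold_paracompact : paracompact M;
  dom_open : forall c, open (dom c);
  dom_cover : \bigcup_c dom c = setT;
  img_open : forall c, open (chart c @` dom c);
  chartK : forall c x, dom c x -> chart_inv c (chart c x) = x;
  chart_cts : forall c, {within dom c, continuous (chart c)};
  chart_inv_cts : forall c, {within chart c @` dom c, continuous (chart_inv c)};
  transition_smooth : forall c c' (i : 'I_n),
    smooth_on (chart c @` (dom c `&` dom c'))
              (fun x => chart c' (chart_inv c x) 0 i) }.

(* An index of kind Hor is a Greek (horizontal) one, an index of kind Ver a
   Latin (vertical) one. *)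
Inductive kind := Hor | Ver.

Definition same_kind (s t : kind) : bool :=
  match s, t with Hor, Hor | Ver, Ver => true | _, _ => false end.

Section LocalGeometry.
Variables (R : realType) (n : nat).

(* the pair (x, y) of the induced coordinates *)
Definition tpt : Type := ('rV[R]_n * 'rV[R]_n)%type.

Definition coord (s : kind) (i : 'I_n) (p : tpt) : R :=
  match s with Hor => p.1 0 i | Ver => p.2 0 i end.

Definition coord_vec (s : kind) (i : 'I_n) : 'rV[R]_n * 'rV[R]_n :=
  match s with Hor => (delta_mx 0 i, 0) | Ver => (0, delta_mx 0 i) end.

(* d/dx^i for s = Hor, d/dy^i for s = Ver *)
Definition pd (s : kind) (i : 'I_n) (f : tpt -> R) : tpt -> R :=
  fun p => 'D_(coord_vec s i) (f : 'rV[R]_n * 'rV[R]_n -> R) p.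

(* Components in the natural frame (d/dx^i, d/dy^i): X s i p. *)
Definition lvec := kind -> 'I_n -> tpt -> R.

Definition vact (X : lvec) (f : tpt -> R) : tpt -> R := fun p =>
  \sum_i X Hor i p * pd Hor i f p + \sum_i X Ver i p * pd Ver i f p.

Definition lie_bracket (X Y : lvec) : lvec := fun s i p =>
  vact X (Y s i) p - vact Y (X s i) p.

(* The component N^a_mu is N a mu. *)
Variable N : 'I_n -> 'I_n -> tpt -> R.

(* delta_i for s = Hor, d/dy^i for s = Ver, as a differential operator ... *)
Definition fd (s : kind) (i : 'I_n) (f : tpt -> R) : tpt -> R := fun p =>
  match s with
  | Hor => pd Hor i f p - \sum_a N a i p * pd Ver a f p
  | Ver => pd Ver i f p
  end.

(* ... and as a vector field. *)
Definition frame (s : kind) (i : 'I_n) : lvec := fun t j p =>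
  match s, t with
  | Hor, Hor | Ver, Ver => (i == j)%:R
  | Hor, Ver => - N j i p
  | Ver, Hor => 0
  end.

(* Passage from components in the natural frame to components in the adapted
   frame, and back. *)
Definition adapted (X : lvec) : lvec := fun s i p =>
  match s with
  | Hor => X Hor i p
  | Ver => X Ver i p + \sum_m N i m p * X Hor m p
  end.

Definition of_adapted (Z : lvec) : lvec := fun s i p =>
  match s with
  | Hor => Z Hor i p
  | Ver => Z Ver i p - \sum_m N i m p * Z Hor m p
  end.

(* Coefficients of a d-connection: for D, the coefficients
   Gamma^alpha_{mu nu}, Gamma^a_{b nu}, C^alpha_{mu c}, C^a_{bc} are
   D Hor Hor alpha mu nu, D Ver Hor a b nu, D Hor Ver alpha mu c and
   D Ver Ver a b c; the last index is the direction of differentiation. *)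
Definition dcoef := kind -> kind -> 'I_n -> 'I_n -> 'I_n -> tpt -> R.

(* Covariant derivatives (h- for d = Hor, v- for d = Ver) of a d-tensor with
   one upper index of kind s, and of a d-tensor with one upper index of kind s
   and one lower index of kind t. *)
Definition cov (D : dcoef) (s d : kind) (T : 'I_n -> tpt -> R)
    (i k : 'I_n) : tpt -> R := fun p =>
  fd d k (T i) p + \sum_e T e p * D s d i e k p.

Definition cov2 (D : dcoef) (s t d : kind) (T : 'I_n -> 'I_n -> tpt -> R)
    (i j k : 'I_n) : tpt -> R := fun p =>
  fd d k (T i j) p + \sum_e T e j p * D s d i e k p
                   - \sum_e T i e p * D t d e j k p.

(* D_X Y *)
Definition nabla (D : dcoef) (X Y : lvec) : lvec :=
  of_adapted (fun s i p =>
    \sum_k adapted X Hor k p * cov D s Hor (adapted Y s) i k p +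
    \sum_k adapted X Ver k p * cov D s Ver (adapted Y s) i k p).

Definition curvature (D : dcoef) (X Y Z : lvec) : lvec := fun s i p =>
  nabla D X (nabla D Y Z) s i p - nabla D Y (nabla D X Z) s i p
  - nabla D (lie_bracket X Y) Z s i p.

Definition curvR (D : dcoef) (al be mu nu : 'I_n) : tpt -> R :=
  adapted (curvature D (frame Hor mu) (frame Hor nu) (frame Hor be)) Hor al.

Definition curvS (D : dcoef) (a b c d : 'I_n) : tpt -> R :=
  adapted (curvature D (frame Ver c) (frame Ver d) (frame Ver b)) Ver a.

(* lam l s i is the adapted component of kind s and index i of lambda_l. *)
Variable lam : 'I_n -> lvec.

Definition lam_mx (s : kind) (p : tpt) : 'M[R]_n := \matrix_(l, i) lam l s i p.

(* the inverse matrices (lambda_{i alpha}), (lambda_{i a}) *)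
Definition colam (l : 'I_n) (s : kind) (i : 'I_n) (p : tpt) : R :=
  invmx (lam_mx s p) i l.

Definition canonical_dconn : dcoef := fun s d i j k p =>
  \sum_l lam l s i p * fd d k (colam l s j) p.

Definition dual_dconn : dcoef := fun s d i j k p =>
  if same_kind s d then canonical_dconn s d i k j p
  else canonical_dconn s d i j k p.

Definition symmetric_dconn : dcoef := fun s d i j k p =>
  if same_kind s d
  then 2^-1 * (canonical_dconn s d i j k p + canonical_dconn s d i k j p)
  else canonical_dconn s d i j k p.

(* W s t d i e j k is the component with upper index i and first lower index e,
   both of kind s, followed by the lower indices j of kind t and k of kind d.
   The W-tensors are the six families with (t, d) = (Hor, Hor), (Hor, Ver) and
   (Ver, Ver). *)
Definition wcoef :=
  kind -> kind -> kind -> 'I_n -> 'I_n -> 'I_n -> 'I_n -> tpt -> R.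

(* lambda^i_{;j;k} - lambda^i_{;k;j}, with ;j of kind t and ;k of kind d *)
Definition cov_comm (D : dcoef) (X : lvec) (s t d : kind) (i j k : 'I_n)
    : tpt -> R := fun p =>
  cov2 D s t d (cov D s t (X s)) i j k p - cov2 D s d t (cov D s d (X s)) i k j p.

Definition is_Wtensors (U : set tpt) (D : dcoef) (W : wcoef) : Prop :=
  forall (l : 'I_n) (s : kind) (i j k : 'I_n) (p : tpt), U p ->
  let law t d :=
    cov_comm D (lam l) s t d i j k p = \sum_e lam l s e p * W s t d i e j k p in
  [/\ law Hor Hor, law Hor Ver & law Ver Ver].

(* The defining requirement determines W uniquely where the lambda_l^i are
   invertible, and can be met. *)
Lemma Wtensors_exist (U : set tpt) (D : dcoef) :
  (forall s p, U p -> row_free (lam_mx s p)) -> exists W, is_Wtensors U D W.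
Proof.
move=> lamU; exists (fun s t d i e j k p =>
  \sum_l colam l s e p * cov_comm D (lam l) s t d i j k p).
move=> l s i j k p Up.
have lamK l' : \sum_e lam l s e p * colam l' s e p = (l == l')%:R.
  have U1 : lam_mx s p \in unitmx by rewrite -row_free_unit lamU.
  have /matrixP/(_ l l') := mulmxV U1.
  by rewrite !mxE => <-; apply: eq_bigr => e _; rewrite mxE.
have E t d : cov_comm D (lam l) s t d i j k p = \sum_e lam l s e p *
    (\sum_l' colam l' s e p * cov_comm D (lam l') s t d i j k p).
  under eq_bigr do rewrite mulr_sumr.
  rewrite exchange_big /=.
  under eq_bigr do (under eq_bigr do rewrite mulrA; rewrite -mulr_suml lamK).
  rewrite (bigD1 l) //= eqxx mul1r [X in _ + X]big1 ?addr0 // => l' l'l.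
  by rewrite eq_sym (negbTE l'l) mul0r.
by split; exact: E.
Qed.

End LocalGeometry.

(* The atlas of M induces the charts tdom c of TM. Objects on TM are given by
   their components in all these charts, subject to the transformation laws. *)
Section TangentBundle.
Variables (R : realType) (n : nat) (M : topologicalType).
Variable A : smoothManifold R n M.

Definition tdom (c : chart_index A) : set (tpt R n) :=
  [set p | (chart c @` dom c) p.1].

Definition toverlap (c c' : chart_index A) : set (tpt R n) :=
  [set p | (chart c @` (dom c `&` dom c')) p.1].

Definition transition (c c' : chart_index A) (x : 'rV[R]_n) : 'rV[R]_n :=
  chart c' (chart_inv c x).

Definition jacobian (c c' : chart_index A) (i j : 'I_n) (x : 'rV[R]_n) : R :=
  'D_(delta_mx 0 j) (fun z => transition c c' z 0 i) x.

(* x' = x'(x), y'^a = (dx'^a / dx^b) y^b *)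
Definition ttransition (c c' : chart_index A) (p : tpt R n) : tpt R n :=
  (transition c c' p.1, \row_a \sum_b jacobian c c' a b p.1 * p.2 0 b).

Record nonlinear_connection := {
  ncoef :> chart_index A -> 'I_n -> 'I_n -> tpt R n -> R;
  ncoef_smooth : forall c a mu,
    smooth_on (tdom c) (ncoef c a mu : 'rV[R]_n * 'rV[R]_n -> R);
  (* delta_nu = (dx'^mu / dx^nu) delta'_mu *)
  ncoef_law : forall c c' p, toverlap c c' p -> forall nu s i,
    vact (frame (ncoef c) Hor nu)
         (fun q => coord s i (ttransition c c' q)) p =
    \sum_mu jacobian c c' mu nu p.1 *
            frame (ncoef c') Hor mu s i (ttransition c c' p) }.

Record vector_field := {
  vcoef :> chart_index A -> lvec R n;
  vcoef_smooth : forall c s i,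
    smooth_on (tdom c) (vcoef c s i : 'rV[R]_n * 'rV[R]_n -> R);
  vcoef_law : forall c c' p, toverlap c c' p -> forall s i,
    vcoef c' s i (ttransition c c' p) =
    vact (vcoef c) (fun q => coord s i (ttransition c c' q)) p }.

Record EAP_space := {
  eap_N : nonlinear_connection;
  eap_lambda : 'I_n -> vector_field;
  eap_indep : forall c s p, tdom c p ->
    row_free (lam_mx (fun l => adapted (eap_N c) (eap_lambda l c)) s p) }.

End TangentBundle.

Section EAPChart.
Variables (R : realType) (n : nat) (M : topologicalType).
Variables (A : smoothManifold R n M) (E : EAP_space A) (c : chart_index A).

Definition loc_N : 'I_n -> 'I_n -> tpt R n -> R := eap_N E c.

Definition loc_lambda (l : 'I_n) : lvec R n :=
  adapted loc_N (eap_lambda E l c).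

Definition eap_dual : dcoef R n := dual_dconn loc_N loc_lambda.

Definition eap_symmetric : dcoef R n := symmetric_dconn loc_N loc_lambda.

Definition is_eap_Wtensors (D : dcoef R n) (W : wcoef R n) : Prop :=
  is_Wtensors loc_N loc_lambda (tdom c) D W.

End EAPChart.

(* Main.v *)
Require Import Defs.
From HB Require Import structures.
From mathcomp Require Import all_boot all_order all_algebra.
From mathcomp Require Import all_classical all_reals all_analysis.
From mathcomp Require Import ring lra.

(* With respect to the canonical connection every covariant derivative of the
   lambda's vanishes. The dual and the symmetric connection agree with the
   canonical one in the mixed types (index kind different from the kind of the
   direction), so there their covariant derivatives of lambda vanish too, and in
   the pure types the symmetric one is the mean of the canonical and the dual
   one, whence lambda_{;k} for the symmetric connection is half of lambda_{;k}
   for the dual one. This gives the two vanishing statements, (b) and (c).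
   For (a) and (d) the Ricci identity expresses the commutator of covariant
   derivatives by curvature, torsion and the bracket of the frame vectors; the
   torsion term drops out by symmetry, and the bracket, being vertical, is
   paired with a covariant derivative that vanishes. *)

Set Implicit Arguments.
Unset Strict Implicit.
Unset Printing Implicit Defensive.

Import Order.TTheory GRing.Theory Num.Theory.
Import numFieldNormedType.Exports.

Local Open Scope classical_set_scope.
Local Open Scope ring_scope.

(** * Symmetry of second derivatives *)

Section Schwarz.
Variables (R : realType) (V : normedModType R).
Implicit Types (f : V -> R) (U : set V).

(** The closing estimate of [derive_comm]: cancelling [h] twice in the two expressions of one second
    difference gives [c = d], and [a] and [b] lie within [e / 2] of this common value. *)
Let dist_le_halves (a b c d e h l l' : R) : 0 < h ->
  `|a - c| < e / 2 -> `|b - d| < e / 2 -> l = l' ->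
  l = h * (h * c) -> l' = h * (h * d) -> `|a - b| <= e.
Proof.
move=> h0 ac bd -> -> /(mulfI (lt0r_neq0 h0))/(mulfI (lt0r_neq0 h0)) cd.
rewrite (splitr e) (le_trans (ler_distD c _ _)) // lerD // ltW //.
by rewrite cd distrC.
Qed.

Let subrACA (a b c d : R) : a - b - (c - d) = a - c - (b - d).
Proof. by ring. Qed.

(** Both difference quotients are the same function of the increment. This gives directional
    derivatives access to the one-variable mean value theorem. *)
Lemma is_derive_line f (x v : V) (t : R) :
  derivable f (x + t *: v) v ->
  is_derive t 1 (fun t => f (x + t *: v)) ('D_v f (x + t *: v)).
Proof.
have E : (fun h : R => h^-1 *: ((fun t => f (x + t *: v)) (h *: 1 + t)
                       - f (x + t *: v)))
       = (fun h : R => h^-1 *: (f (h *: v + (x + t *: v)) - f (x + t *: v))).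
  apply/funext => h; congr (_ *: (f _ - _)).
  by rewrite [h *: 1]mulr1 scalerDl addrCA.
by move=> df; split; rewrite /derivable /derive /= E.
Qed.

Lemma MVT_line f (x v : V) (h : R) : 0 <= h ->
  (forall t, 0 <= t <= h -> derivable f (x + t *: v) v) ->
  exists2 t, 0 <= t <= h & f (x + h *: v) - f x = h * 'D_v f (x + t *: v).
Proof.
move=> h0 df.
have [||c] := @MVT_segment R (fun t => f (x + t *: v))
    (fun t => 'D_v f (x + t *: v)) 0 h h0.
- move=> t; rewrite in_itv /= => /andP[/ltW t0 /ltW th].
  by apply/is_derive_line/df; rewrite t0.
- apply: (@derivable_within_continuous R R _ `[0, h]) => t.
  rewrite in_itv /= => th.
  by have [] := is_derive_line (df _ th).
rewrite in_itv /= scale0r addr0 subr0 => ch E.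
by exists c => //; rewrite E mulrC.
Qed.

Lemma growth_rate_shift f (x u v : V) :
  (fun h : R =>
     h^-1 *: (((fun y => f (y + u)) \o shift x) (h *: v) - f (x + u))) =
  (fun h : R => h^-1 *: ((f \o shift (x + u)) (h *: v) - f (x + u))).
Proof. by apply/funext => h /=; rewrite addrA. Qed.

Lemma derive_shift_arg f (x u v : V) :
  'D_v (fun y => f (y + u)) x = 'D_v f (x + u).
Proof. by rewrite /derive growth_rate_shift. Qed.

Lemma derivable_shift_arg f (x u v : V) :
  derivable f (x + u) v -> derivable (fun y => f (y + u)) x v.
Proof. by rewrite /derivable growth_rate_shift. Qed.

(** The second difference is the first difference along [v] of [f (y + h *: w) - f y]. The mean
    value theorem along [v] turns it into a difference of ['D_v f], to which the theorem along [w]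
    applies. *)
Lemma MVT_square f (p v w : V) (h : R) : 0 <= h ->
  (forall s t, 0 <= s <= h -> 0 <= t <= h ->
     derivable f (p + s *: v + t *: w) v /\
     derivable ('D_v f) (p + s *: v + t *: w) w) ->
  exists s t, [/\ 0 <= s <= h, 0 <= t <= h &
    f (p + h *: v + h *: w) - f (p + h *: v) - (f (p + h *: w) - f p) =
    h * (h * 'D_w ('D_v f) (p + s *: v + t *: w))].
Proof.
move=> h0 df.
have h00 : 0 <= (0 : R) <= h by rewrite lexx.
have hh : 0 <= h <= h by rewrite lexx andbT.
have d0 s : 0 <= s <= h -> derivable f (p + s *: v) v.
  by move=> sh; have [] := df s 0 sh h00; rewrite scale0r addr0.
have d1 s : 0 <= s <= h ->
    derivable (fun y => f (y + h *: w)) (p + s *: v) v.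
  by move=> sh; apply: (@derivable_shift_arg f _ (h *: w));
    have [] := df s h sh hh.
have [s sh E] := @MVT_line (fun y => f (y + h *: w) - f y) p v h h0
  (fun s sh => derivableB (d1 s sh) (d0 s sh)).
have [t th E'] := @MVT_line ('D_v f) (p + s *: v) w h h0
  (fun t th => (df s t sh th).2).
exists s, t; split=> //.
have -> : f (p + h *: v + h *: w) - f (p + h *: v) - (f (p + h *: w) - f p) =
    h * 'D_v ((fun y => f (y + h *: w)) - f) (p + s *: v) by exact: E.
rewrite deriveB; [|exact: d1|exact: d0].
by rewrite derive_shift_arg E'.
Qed.

(* The second difference on a square of side h is h^2 times either mixed
   derivative at points of the square; continuity at p then identifies them. *)
Lemma derive_comm U f (p v w : V) : open U -> is_Ck 2 U f -> U p ->
  'D_w ('D_v f) p = 'D_v ('D_w f) p.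
Proof.
move=> Uo [_ /= f2] Up.
have [dv [_ cv]] := f2 v; have [dvw [cvw _]] := cv w.
have [dw [_ cw]] := f2 w; have [dwv [cwv _]] := cw v.
apply/eqP; rewrite -subr_eq0 -normr_le0; apply/ler_addgt0Pl => e e0.
rewrite addr0.
have e2 : 0 < e / 2 by rewrite divr_gt0.
have := cvw _ Up; move/cvgrPdist_lt => /(_ _ e2) C1.
have := cwv _ Up; move/cvgrPdist_lt => /(_ _ e2) C2.
have C3 : \forall q \near p, U q by apply: open_nbhs_nbhs.
have N : nbhs p (U `&` ([set q | `|'D_w ('D_v f) p - 'D_w ('D_v f) q| < e / 2] `&`
                        [set q | `|'D_v ('D_w f) p - 'D_v ('D_w f) q| < e / 2])).
  exact: filterI C3 (filterI C1 C2).
move: N => /nbhs_ballP [r /= r0 B].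
(* This side keeps the whole square spanned by [v] and [w] inside the ball; the summand 1 keeps the
   denominator positive when [v] and [w] are both 0. *)
pose h := r / (2 * (1 + `|v| + `|w|)).
have k0 : 0 < 1 + `|v| + `|w|.
  by rewrite -addrA ltr_pwDl // addr_ge0.
have h0 : 0 < h by rewrite divr_gt0 // mulr_gt0.
have hr : h * (`|v| + `|w|) < r.
  have -> : r = h * (2 * (1 + `|v| + `|w|)).
    by rewrite /h mulfVK // gt_eqF // mulr_gt0.
  rewrite ltr_pM2l //; have := normr_ge0 v; have := normr_ge0 w; lra.
have Bst s t : 0 <= s <= h -> 0 <= t <= h -> ball p r (p + s *: v + t *: w).
  move=> /andP[s0 sh] /andP[t0 th]; rewrite -ball_normE /=.
  rewrite -addrA opprD addNKr normrN (le_lt_trans (ler_normD _ _)) //.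
  rewrite !normrZ !ger0_norm // (le_lt_trans _ hr) // mulrDr.
  by rewrite lerD // ler_wpM2r.
have Bts s t : 0 <= s <= h -> 0 <= t <= h -> ball p r (p + s *: w + t *: v).
  by move=> sh th; rewrite addrAC; apply: Bst.
have [|s [t [sh th E]]] := @MVT_square f p v w h (ltW h0).
  move=> s t sh th; have [Uq _] := B _ (Bst _ _ sh th).
  by split; [exact: dv|exact: dvw].
have [|s' [t' [sh' th' E']]] := @MVT_square f p w v h (ltW h0).
  move=> s' t' sh' th'; have [Uq _] := B _ (Bts _ _ sh' th').
  by split; [exact: dw|exact: dwv].
have [_ [D1 _]] := B _ (Bst _ _ sh th).
have [_ [_ D2]] := B _ (Bts _ _ sh' th').
apply: (dist_le_halves h0 D1 D2 _ E E').
by rewrite (addrAC p (h *: w)); exact: subrACA.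
Qed.

End Schwarz.

(** * Closure properties of smooth functions *)

Section Smooth.
Variables (R : realType) (V : normedModType R) (U : set V).
Hypothesis openU : open U.
Implicit Types f g : V -> R.

Lemma near_open (P : V -> Prop) x : U x -> (forall y, U y -> P y) ->
  \near x, P x.
Proof.
move=> Ux UP; apply: (@filterS _ (nbhs x) _ U) => //.
exact: open_nbhs_nbhs.
Qed.

Lemma derive_eq_on f g x v : {in U, f =1 g} -> U x -> 'D_v f x = 'D_v g x.
Proof.
move=> fg Ux; apply: near_eq_derive; apply: near_open Ux _ => y Uy.
by apply: fg; rewrite inE.
Qed.

(** As [U] is open, agreement on [U] is agreement near each of its points, so limits and derivatives
    coincide there. The closure lemmas below use this to replace a derivative by the formula that
    computes it on [U]. *)
Lemma is_Ck_eq_on k f g : {in U, f =1 g} -> is_Ck k U f -> is_Ck k U g.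
Proof.
move=> fg; have nfg (h1 h2 : V -> R) : {in U, h1 =1 h2} ->
    forall x, U x -> \near x, h1 x = h2 x.
  by move=> h12 x Ux; apply: near_open Ux _ => y Uy; apply: h12; rewrite inE.
have ctsg (h1 h2 : V -> R) : {in U, h1 =1 h2} ->
    (forall x, U x -> {for x, continuous h1}) ->
    forall x, U x -> {for x, continuous h2}.
  move=> h12 ch1 x Ux; have /= := ch1 x Ux; rewrite /prop_for /continuous_at.
  rewrite h12 ?inE //; apply: cvg_trans; apply: near_eq_cvg.
  exact: nfg.
elim: k f g fg => [|k IH] f g fg [cf df]; split=> //; try exact: ctsg cf.
move=> v; have [dv cv] := df v; split.
  by move=> x Ux; apply: near_eq_derivable (nfg _ _ fg x Ux) (dv x Ux).
by apply: IH cv => x; rewrite inE => Ux; exact: derive_eq_on.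
Qed.

Lemma is_CkW k f : is_Ck k.+1 U f -> is_Ck k U f.
Proof.
elim: k f => [|k IH] f [cf df]; first by split.
by split=> // v; have [dv cv] := df v; split=> //; exact: IH.
Qed.

Lemma is_Ck_cst k (a : R) : is_Ck k U (fun=> a).
Proof.
have cc (b : R) (x : V) : {for x, continuous (fun _ : V => b)}.
  exact: cst_continuous.
elim: k a => [|k IH] a; split=> // v.
split; first by move=> x _; exact: derivable_cst.
apply: is_Ck_eq_on (IH 0) => x _.
by rewrite [RHS](@derive_cst _ V R^o a x v).
Qed.

Lemma is_CkD k f g : is_Ck k U f -> is_Ck k U g ->
  is_Ck k U (fun x => f x + g x).
Proof.
elim: k f g => [|k IH] f g [cf df] [cg dg].
all: split=> [x Ux|]; first by apply: cvgD; [exact: cf|exact: cg].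
- by [].
- move=> v; have [dfv cfv] := df v; have [dgv cgv] := dg v; split.
    by move=> x Ux; apply: derivableD; [exact: dfv|exact: dgv].
  apply: is_Ck_eq_on (IH _ _ cfv cgv) => x; rewrite inE => Ux.
  by rewrite [RHS]deriveD //; [exact: dfv|exact: dgv].
Qed.

(** The Leibniz rule pairs each derivative with an undifferentiated factor, so the induction also
    needs [f] and [g] at the lower order, which [is_CkW] supplies. *)
Lemma is_CkM k f g : is_Ck k U f -> is_Ck k U g ->
  is_Ck k U (fun x => f x * g x).
Proof.
elim: k f g => [|k IH] f g.
  by move=> [cf _] [cg _]; split=> // x Ux; apply: cvgM; [exact: cf|exact: cg].
move=> Cf Cg; have Cf' := is_CkW Cf; have Cg' := is_CkW Cg.
have [cf df] := Cf; have [cg dg] := Cg.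
split=> [x Ux|v]; first by apply: cvgM; [exact: cf|exact: cg].
have [dfv cfv] := df v; have [dgv cgv] := dg v; split.
  by move=> x Ux; apply: derivableM; [exact: dfv|exact: dgv].
apply: is_Ck_eq_on (is_CkD (IH _ _ Cf' cgv) (IH _ _ Cg' cfv)) => x.
rewrite inE => Ux.
by rewrite [RHS]deriveM //; [exact: dfv|exact: dgv].
Qed.

(** The derivative of [1/f] is [- 'D_v f * (1/f)^2]: one order more for [1/f] follows from the
    current order of [1/f] and the product rule. *)
Lemma is_CkV k f : (forall x, U x -> f x != 0) -> is_Ck k U f ->
  is_Ck k U (fun x => (f x)^-1).
Proof.
move=> f0; elim: k => [|k IH].
  by move=> [cf _]; split=> // x Ux; apply: cvgV; [exact: f0|exact: cf].
move=> Cf; have Cf' := IH (is_CkW Cf); have [cf df] := Cf.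
split=> [x Ux|v]; first by apply: cvgV; [exact: f0|exact: cf].
have [dfv cfv] := df v; split.
  by move=> x Ux; apply: derivableV; [exact: f0|exact: dfv].
apply: is_Ck_eq_on (is_CkM (is_Ck_cst k (-1))
  (is_CkM cfv (is_CkM Cf' Cf'))) => x; rewrite inE => Ux.
rewrite [RHS]deriveV; [|exact: f0|exact: dfv].
by rewrite mulN1r scaleNr -exprVn expr2 [RHS]/(- (_ * _)) [in RHS]mulrC.
Qed.

Lemma smooth_eq_on f g : {in U, f =1 g} -> smooth_on U f -> smooth_on U g.
Proof. by move=> fg sf k; apply: is_Ck_eq_on (sf k). Qed.

Lemma smooth_cst (a : R) : smooth_on U (fun=> a).
Proof. by move=> k; exact: is_Ck_cst. Qed.

Lemma smoothD f g : smooth_on U f -> smooth_on U g ->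
  smooth_on U (fun x => f x + g x).
Proof. by move=> sf sg k; exact: is_CkD. Qed.

Lemma smoothM f g : smooth_on U f -> smooth_on U g ->
  smooth_on U (fun x => f x * g x).
Proof. by move=> sf sg k; exact: is_CkM. Qed.

Lemma smoothN f : smooth_on U f -> smooth_on U (fun x => - f x).
Proof.
move=> sf; apply: smooth_eq_on (smoothM (smooth_cst (-1)) sf) => x _.
by rewrite mulN1r.
Qed.

Lemma smoothB f g : smooth_on U f -> smooth_on U g ->
  smooth_on U (fun x => f x - g x).
Proof. by move=> sf sg; apply/smoothD/smoothN. Qed.

Lemma smoothV f : (forall x, U x -> f x != 0) -> smooth_on U f ->
  smooth_on U (fun x => (f x)^-1).
Proof. by move=> f0 sf k; exact: is_CkV. Qed.

Lemma smooth_sum (I : Type) (r : seq I) (P : pred I) (F : I -> V -> R) :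
  (forall i, P i -> smooth_on U (F i)) ->
  smooth_on U (fun x => \sum_(i <- r | P i) F i x).
Proof.
move=> sF; elim: r => [|i r IH].
  by apply: smooth_eq_on (smooth_cst 0) => x _; rewrite big_nil.
case Pi: (P i).
  apply: smooth_eq_on (smoothD (sF i Pi) IH) => x _.
  by rewrite big_cons Pi.
by apply: smooth_eq_on IH => x _; rewrite big_cons Pi.
Qed.

Lemma smooth_prod (I : Type) (r : seq I) (F : I -> V -> R) :
  (forall i, smooth_on U (F i)) ->
  smooth_on U (fun x => \prod_(i <- r) F i x).
Proof.
move=> sF; elim: r => [|i r IH].
  by apply: smooth_eq_on (smooth_cst 1) => x _; rewrite big_nil.
by apply: smooth_eq_on (smoothM (sF i) IH) => x _; rewrite big_cons.
Qed.

Lemma smooth_derive f v : smooth_on U f -> smooth_on U ('D_v f).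
Proof. by move=> sf k; have [_ /(_ v)[]] := sf k.+1. Qed.

Lemma smooth_derivable f x v : smooth_on U f -> U x -> derivable f x v.
Proof. by move=> /(_ 1)[_ /(_ v)[d _]]; exact: d. Qed.

Lemma smooth_det m (B : V -> 'M[R]_m) :
  (forall i j, smooth_on U (fun x => B x i j)) ->
  smooth_on U (fun x => \det (B x)).
Proof.
move=> sB; rewrite /determinant.
apply: smooth_sum => s _; apply: smoothM; first exact: smooth_cst.
exact: smooth_prod.
Qed.

(** Cramer's rule: entry [i j] of the inverse is the cofactor [j i] over the determinant, and
    determinants are polynomials in the entries. *)
Lemma smooth_invmx m (B : V -> 'M[R]_m) :
  (forall x, U x -> B x \in unitmx) ->
  (forall i j, smooth_on U (fun x => B x i j)) ->
  forall i j, smooth_on U (fun x => invmx (B x) i j).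
Proof.
move=> uB sB i j.
have s1 : smooth_on U (fun x => (\det (B x))^-1 * cofactor (B x) j i).
  apply: smoothM.
    apply: smoothV => [x /uB|]; last exact: smooth_det.
    by rewrite unitmxE unitfE.
  rewrite /cofactor; apply: smoothM; first exact: smooth_cst.
  apply: smooth_det => k l.
  by apply: smooth_eq_on (sB (lift j k) (lift i l)) => x _; rewrite !mxE.
apply: smooth_eq_on s1 => x; rewrite inE => Ux.
by rewrite /invmx uB // !mxE.
Qed.

End Smooth.

(** * Calculus in the adapted frame *)

Section AdaptedFrame.
Variables (R : realType) (n : nat).
Implicit Types (f g : tpt R n -> R) (p : tpt R n).
Variable N : 'I_n -> 'I_n -> tpt R n -> R.
Local Notation fd := (fd N).
Local Notation frame := (frame N).
Local Notation adapted := (adapted N).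

Lemma pd_cst s i (a : R) p : pd s i (fun=> a) p = 0.
Proof. exact: (@derive_cst _ _ R^o a). Qed.

Lemma fd_cst d k (a : R) p : fd d k (fun=> a) p = 0.
Proof.
case: d; rewrite /Defs.fd ?pd_cst // big1 ?subr0 // => i _.
by rewrite pd_cst mulr0.
Qed.

(** The Boolean [b] matches the indicators of [adapted_frame], which test the kinds together with
    the indices. *)
Lemma sum_delta (F : 'I_n -> R) (b : bool) j :
  \sum_i (b && (j == i))%:R * F i = b%:R * F j.
Proof.
rewrite (bigD1 j) //= eqxx andbT big1 ?addr0 // => i ij.
by rewrite eq_sym (negbTE ij) andbF mul0r.
Qed.

Lemma sum_delta1 (F : 'I_n -> R) j : \sum_i (j == i)%:R * F i = F j.
Proof. by have := sum_delta F true j; rewrite mul1r. Qed.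

Lemma vact_frame d j f p : vact (frame d j) f p = fd d j f p.
Proof.
case: d; rewrite /vact /Defs.fd /=.
  rewrite -sumrN; congr (_ + _); first exact: sum_delta1.
  by apply: eq_bigr => i _; rewrite mulNr.
rewrite [X in X + _]big1 => [|i _]; last by rewrite mul0r.
by rewrite add0r; exact: sum_delta1.
Qed.

Lemma adapted_frame d j t i p :
  adapted (frame d j) t i p = (same_kind d t && (j == i))%:R.
Proof.
case: d t => -[] //=.
  by under eq_bigr do rewrite mulrC; rewrite sum_delta1 addNr.
by rewrite big1 ?addr0 // => i' _; rewrite mulr0.
Qed.

Lemma of_adaptedK (Z : lvec R n) s i p :
  adapted (of_adapted N Z) s i p = Z s i p.
Proof. by case: s => //=; rewrite subrK. Qed.

Lemma adapted_nabla D X Y s i p : adapted (nabla N D X Y) s i p =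
  \sum_k adapted X Hor k p * cov N D s Hor (adapted Y s) i k p +
  \sum_k adapted X Ver k p * cov N D s Ver (adapted Y s) i k p.
Proof. exact: of_adaptedK. Qed.

Lemma adapted_nabla_frame D d k Y s i p :
  adapted (nabla N D (frame d k) Y) s i p = cov N D s d (adapted Y s) i k p.
Proof.
rewrite adapted_nabla; under eq_bigr do rewrite adapted_frame.
under [X in _ + X]eq_bigr do rewrite adapted_frame.
by rewrite !sum_delta; case: d; rewrite /= mul0r mul1r (addr0, add0r).
Qed.

Lemma cov_frame D d k s e i p :
  cov N D s d (adapted (frame s e) s) i k p = D s d i e k p.
Proof.
rewrite /cov; have -> : adapted (frame s e) s i = fun=> (e == i)%:R.
  by apply/funext => q; rewrite adapted_frame; case: s.
rewrite fd_cst add0r; under eq_bigr do rewrite adapted_frame.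
by rewrite sum_delta; case: s; rewrite mul1r.
Qed.

(** The horizontal part of the bracket vanishes by [lie_bracket_Hor], so the vertical part is all of
    it. For [d = Hor] it is, up to sign convention, the curvature of [N]; for [d = Ver] it is
    zero. *)
Definition frame_bracket d k j m : tpt R n -> R :=
  adapted (lie_bracket (frame d k) (frame d j)) Ver m.

Lemma lie_bracket_Hor d k j m p :
  lie_bracket (frame d k) (frame d j) Hor m p = 0.
Proof.
rewrite /lie_bracket !vact_frame.
by case: d; rewrite [X in X - _]fd_cst [X in _ - X]fd_cst subr0.
Qed.

Lemma frame_bracketE d k j m p : frame_bracket d k j m p =
  fd d k (frame d j Ver m) p - fd d j (frame d k Ver m) p.
Proof.
rewrite /frame_bracket /= big1 ?addr0 => [|i _].
  by rewrite /lie_bracket !vact_frame.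
by rewrite lie_bracket_Hor mulr0.
Qed.

Lemma adaptedB (X Y : lvec R n) s i p :
  adapted (fun s i p => X s i p - Y s i p) s i p =
  adapted X s i p - adapted Y s i p.
Proof.
case: s => //=; under eq_bigr do rewrite mulrBr.
by rewrite sumrB opprD addrACA.
Qed.

(** Frame vectors have constant adapted components, so their first covariant derivatives are the
    coefficients themselves; differentiating once more gives the derivative and quadratic terms. The
    bracket is vertical and meets only the [Ver] coefficients. *)
Lemma curvature_frame D d k j s i e p :
  adapted (curvature N D (frame d k) (frame d j) (frame s e)) s i p =
  fd d k (D s d i e j) p - fd d j (D s d i e k) p
  + \sum_f D s d f e j p * D s d i f k p - \sum_f D s d f e k p * D s d i f j p
  - \sum_m frame_bracket d k j m p * D s Ver i e m p.
Proof.
have E k' : adapted (nabla N D (frame d k') (frame s e)) s =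
            fun i => D s d i e k'.
  by apply/funext => i'; apply/funext => q;
    rewrite adapted_nabla_frame cov_frame.
rewrite /curvature 2!adaptedB !adapted_nabla_frame !E adapted_nabla.
rewrite [X in _ - (X + _)]big1 => [|m _]; last first.
  by rewrite [adapted _ _ _ _]lie_bracket_Hor mul0r.
rewrite add0r; congr (_ - _); last by apply: eq_bigr => m _; rewrite cov_frame.
by rewrite /cov; ring.
Qed.

End AdaptedFrame.

(** * Leibniz rules and commutators of the frame operators *)

Section FrameCalculus.
Variables (R : realType) (n : nat).
Variable U : set ('rV[R]_n * 'rV[R]_n).
Hypothesis openU : open U.
Variable N : 'I_n -> 'I_n -> tpt R n -> R.
Local Notation fd := (fd N).
Local Notation smooth := (@smooth_on R ('rV[R]_n * 'rV[R]_n)%type U).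
Hypothesis smooth_N : forall a m, smooth (N a m).
Implicit Types (f g : tpt R n -> R) (p : tpt R n).

Lemma pd_smooth s i f : smooth f -> smooth (pd s i f).
Proof. exact: smooth_derive. Qed.

Lemma pd_eq_on s i f g p : {in U, f =1 g} -> U p -> pd s i f p = pd s i g p.
Proof. exact: derive_eq_on. Qed.

Lemma pdD s i f g p : smooth f -> smooth g -> U p ->
  pd s i (fun q => f q + g q) p = pd s i f p + pd s i g p.
Proof.
by move=> sf sg Up; rewrite /pd [LHS]deriveD //; exact: smooth_derivable.
Qed.

Lemma pdM s i f g p : smooth f -> smooth g -> U p ->
  pd s i (fun q => f q * g q) p = f p * pd s i g p + g p * pd s i f p.
Proof.
by move=> sf sg Up; rewrite /pd [LHS]deriveM //; exact: smooth_derivable.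
Qed.

Lemma pd_comm s i t j f p : smooth f -> U p ->
  pd s i (pd t j f) p = pd t j (pd s i f) p.
Proof. by move=> sf; apply: derive_comm. Qed.

Lemma fd_smooth d k f : smooth f -> smooth (fd d k f).
Proof.
move=> sf; case: d; last exact: pd_smooth.
apply: smoothB => //; first exact: pd_smooth.
by apply: smooth_sum => // a _; apply: smoothM => //; exact: pd_smooth.
Qed.

Lemma fd_eq_on d k f g p : {in U, f =1 g} -> U p -> fd d k f p = fd d k g p.
Proof.
move=> fg Up; case: d; rewrite /Defs.fd (pd_eq_on _ _ fg) //; congr (_ - _).
by apply: eq_bigr => a _; rewrite (pd_eq_on _ _ fg).
Qed.

Lemma fdD d k f g p : smooth f -> smooth g -> U p ->
  fd d k (fun q => f q + g q) p = fd d k f p + fd d k g p.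
Proof.
move=> sf sg Up; case: d; rewrite /Defs.fd pdD //.
under eq_bigr do rewrite pdD // mulrDr.
by rewrite big_split opprD addrACA.
Qed.

Lemma fdM d k f g p : smooth f -> smooth g -> U p ->
  fd d k (fun q => f q * g q) p = f p * fd d k g p + g p * fd d k f p.
Proof.
move=> sf sg Up; case: d; rewrite /Defs.fd pdM //.
under eq_bigr do rewrite pdM // mulrDr !(mulrCA (N _ _ _)).
by rewrite big_split -!mulr_sumr !mulrBr opprD addrACA.
Qed.

Lemma fdZ d k (a : R) f p : smooth f -> U p ->
  fd d k (fun q => a * f q) p = a * fd d k f p.
Proof.
move=> sf Up; rewrite fdM //; last exact: smooth_cst.
by rewrite fd_cst mulr0 addr0.
Qed.

Lemma fdB d k f g p : smooth f -> smooth g -> U p ->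
  fd d k (fun q => f q - g q) p = fd d k f p - fd d k g p.
Proof.
move=> sf sg Up; have sN : smooth (fun q => -1 * g q).
  by apply: smoothM => //; exact: smooth_cst.
rewrite -mulN1r -fdZ // -fdD //.
by apply: fd_eq_on Up => q _; rewrite mulN1r.
Qed.

Lemma fd_sum (I : Type) (r : seq I) d k (F : I -> tpt R n -> R) p :
  (forall i, smooth (F i)) -> U p ->
  fd d k (fun q => \sum_(i <- r) F i q) p = \sum_(i <- r) fd d k (F i) p.
Proof.
move=> sF Up; elim: r => [|i r IH].
  rewrite big_nil -[RHS](fd_cst N d k 0 p).
  by apply: fd_eq_on Up => q _; rewrite big_nil.
rewrite big_cons -IH -fdD //; last exact: smooth_sum.
by apply: fd_eq_on Up => q _; rewrite big_cons.
Qed.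

Let subr_regroup (a b c d e : R) : a - b - (c - d + e) = a - (b + c - d) - e.
Proof. by ring. Qed.

Let subr_cancel (a b c d : R) : a - b - c - (a - b - d) = d - c.
Proof. by ring. Qed.

(** Second-order terms cancel by the symmetry of partial derivatives; what survives are the
    derivatives of [N], which are the components of the bracket. *)
Lemma fd_comm d k j f p : smooth f -> U p ->
  fd d k (fd d j f) p - fd d j (fd d k f) p =
  \sum_m frame_bracket N d k j m p * pd Ver m f p.
Proof.
move=> sf Up; case: d; last first.
  rewrite {1 2}/Defs.fd pd_comm // subrr big1 // => m _.
  by rewrite frame_bracketE !fd_cst subrr mul0r.
(* [P] collects the terms linear in [N] and [Q] the quadratic ones. [P a b + P b a] and [Q] are
   symmetric, so exchanging the directions leaves only the last sum. *)
have [P [Q [Qsym E]]] : exists P Q : 'I_n -> 'I_n -> R,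
    (forall a b, Q a b = Q b a) /\ forall a b,
    fd Hor a (fd Hor b f) p = pd Hor a (pd Hor b f) p - (P a b + P b a - Q a b)
      - \sum_m pd Ver m f p * fd Hor a (N m b) p.
  exists (fun a b => \sum_m N m a p * pd Ver m (pd Hor b f) p).
  exists (fun a b => \sum_m \sum_l N m b p * (N l a p * pd Ver l (pd Ver m f) p)).
  split=> a b.
    rewrite exchange_big; apply: eq_bigr => l _; apply: eq_bigr => m _.
    by rewrite pd_comm // mulrCA.
  have sV m : smooth (fun q => N m b q * pd Ver m f q).
    by apply: smoothM => //; exact: pd_smooth.
  have -> : fd Hor a (fd Hor b f) p = fd Hor a (pd Hor b f) p -
      \sum_m fd Hor a (fun q => N m b q * pd Ver m f q) p.
    rewrite -fd_sum // -fdB //; [exact: pd_smooth|exact: smooth_sum].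
  have -> : \sum_m fd Hor a (fun q => N m b q * pd Ver m f q) p =
      \sum_m N m b p * pd Ver m (pd Hor a f) p
      - \sum_m \sum_l N m b p * (N l a p * pd Ver l (pd Ver m f) p)
      + \sum_m pd Ver m f p * fd Hor a (N m b) p.
    rewrite -sumrB -big_split; apply: eq_bigr => m _.
    rewrite fdM //; last exact: pd_smooth.
    by rewrite (pd_comm Ver m) // -mulr_sumr -mulrBr.
  exact: subr_regroup.
have -> : \sum_m frame_bracket N Hor k j m p * pd Ver m f p =
    \sum_a pd Ver a f p * fd Hor j (N a k) p -
    \sum_a pd Ver a f p * fd Hor k (N a j) p.
  rewrite -sumrB; apply: eq_bigr => m _; rewrite frame_bracketE.
  have N' a b : fd Hor a (frame N Hor b Ver m) p = - fd Hor a (N m b) p.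
    by rewrite -mulN1r -fdZ //; apply: fd_eq_on Up => q _; rewrite mulN1r.
  rewrite !N' opprK addrC mulrC mulrBr //.
rewrite !E pd_comm // (Qsym j) (addrC (P j k)).
exact: subr_cancel.
Qed.

End FrameCalculus.

(** * The Ricci identity *)

Section Ricci.
Variables (R : realType) (n : nat).
Variable U : set ('rV[R]_n * 'rV[R]_n).
Hypothesis openU : open U.
Variable N : 'I_n -> 'I_n -> tpt R n -> R.
Local Notation fd := (fd N).
Local Notation smooth := (@smooth_on R ('rV[R]_n * 'rV[R]_n)%type U).
Hypothesis smooth_N : forall a m, smooth (N a m).
Implicit Types (D : dcoef R n) (p : tpt R n).

Lemma cov_smooth D s d T i k : (forall i, smooth (T i)) ->
  (forall i j k, smooth (D s d i j k)) -> smooth (cov N D s d T i k).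
Proof.
move=> sT sD; apply: smoothD => //; first exact: fd_smooth.
by apply: smooth_sum => // e _; exact: smoothM.
Qed.

Lemma cov2_eq0 D s t d T i j k p : U p ->
  (forall i j q, U q -> T i j q = 0) -> cov2 N D s t d T i j k p = 0.
Proof.
move=> Up T0; rewrite /cov2 (@fd_eq_on _ _ _ openU N d k _ (fun=> 0) p) //.
  rewrite fd_cst add0r !big1 ?subr0 // => e _.
  by rewrite T0 // mul0r.
  by rewrite T0 // mul0r.
by move=> q; rewrite inE; exact: T0.
Qed.

(** Only coefficients in direction [d] at [p] enter, so [D] and [D'] may differ elsewhere. This
    suits the symmetric and the dual connection, which share their mixed coefficients. *)
Lemma cov2Z D D' s t d (a : R) T T' i j k p : U p ->
  (forall i j, smooth (T' i j)) ->
  (forall i j q, U q -> T i j q = a * T' i j q) ->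
  (forall i j, D s d i j k p = D' s d i j k p) ->
  (forall i j, D t d i j k p = D' t d i j k p) ->
  cov2 N D s t d T i j k p = a * cov2 N D' s t d T' i j k p.
Proof.
move=> Up sT' TT' Ds Dt; rewrite /cov2 !(mulrBr, mulrDr) !mulr_sumr.
rewrite -(fdZ openU) //; congr (_ + _ - _).
- by apply: (@fd_eq_on _ _ _ openU) => // q; rewrite inE; exact: TT'.
- by apply: eq_bigr => e _; rewrite TT' // Ds mulrA.
- by apply: eq_bigr => e _; rewrite TT' // Dt mulrA.
Qed.

Let ricci_arith (a a' c c' m h h' l l' u v x : R) :
  a - a' = u -> x = c - c' + h - h' - v ->
  a + c + m + h - l - (a' + c' + m + h' - l') = x + (l' - l) + (u + v).
Proof. by move=> <- ->; ring. Qed.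

(** After antisymmetrisation, second derivatives of [X] give the bracket through [fd_comm], the
    coefficient terms give curvature, and the corrections for the lower index give torsion. *)
Lemma ricci_identity D (X : lvec R n) s d i j k p : U p ->
  (forall i, smooth (X s i)) -> (forall i j k, smooth (D s d i j k)) ->
  cov_comm N D X s d d i j k p =
  \sum_e X s e p *
    adapted N (curvature N D (frame N d k) (frame N d j) (frame N s e)) s i p
  + \sum_e cov N D s d (X s) i e p * (D d d e k j p - D d d e j k p)
  + \sum_m frame_bracket N d k j m p * cov N D s Ver (X s) i m p.
Proof.
move=> Up sX sD.
(* [M] holds the products of a first derivative of [X] with a coefficient; being symmetric, it
   cancels. *)
have [M [Msym E]] : exists M : 'I_n -> 'I_n -> R, (forall a b, M a b = M b a) /\
    forall a b, cov2 N D s d d (cov N D s d (X s)) i a b p =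
      fd d b (fd d a (X s i)) p + \sum_e X s e p * fd d b (D s d i e a) p + M a b
      + \sum_e X s e p * (\sum_f D s d f e a p * D s d i f b p)
      - \sum_e cov N D s d (X s) i e p * D d d e a b p.
  exists (fun a b => \sum_e (fd d a (X s e) p * D s d i e b p +
                             fd d b (X s e) p * D s d i e a p)).
  split=> a b; first by apply: eq_bigr => e _; rewrite addrC.
  rewrite {1}/cov2; congr (_ - _).
  have -> : fd d b (cov N D s d (X s) i a) p = fd d b (fd d a (X s i)) p +
      \sum_e (X s e p * fd d b (D s d i e a) p +
              D s d i e a p * fd d b (X s e) p).
    rewrite /cov (fdD (U := U)) //; [|exact: fd_smooth|]; last first.
      by apply: smooth_sum => // e _; exact: smoothM.
    rewrite (fd_sum openU) // => [|e]; last exact: smoothM.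
    by congr (_ + _); apply: eq_bigr => e _; rewrite (fdM (U := U)).
  have -> : \sum_e cov N D s d (X s) e a p * D s d i e b p =
      \sum_e fd d a (X s e) p * D s d i e b p +
      \sum_e X s e p * (\sum_f D s d f e a p * D s d i f b p).
    rewrite /cov; under eq_bigr do rewrite mulrDl mulr_suml.
    rewrite big_split exchange_big; congr (_ + _).
    apply: eq_bigr => e _; rewrite mulr_sumr.
    by apply: eq_bigr => f _; rewrite mulrA.
  rewrite addrA !big_split /=; congr (_ + _).
  rewrite -!addrA; congr (_ + (_ + _)); rewrite addrC; congr (_ + _).
  by apply: eq_bigr => e _; rewrite mulrC.
rewrite /cov_comm !E (Msym k j).
have -> : \sum_e cov N D s d (X s) i e p * (D d d e k j p - D d d e j k p) =
    \sum_e cov N D s d (X s) i e p * D d d e k j p -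
    \sum_e cov N D s d (X s) i e p * D d d e j k p.
  by rewrite -sumrB; apply: eq_bigr => e _; rewrite mulrBr.
(* The first sum is the one produced by [fd_comm]; the second cancels the bracket term inside the
   curvature. *)
have -> : \sum_m frame_bracket N d k j m p * cov N D s Ver (X s) i m p =
    \sum_m frame_bracket N d k j m p * pd Ver m (X s i) p +
    \sum_e X s e p * \sum_m frame_bracket N d k j m p * D s Ver i e m p.
  rewrite /cov; under eq_bigr do rewrite mulrDr mulr_sumr.
  rewrite big_split exchange_big; congr (_ + _).
  apply: eq_bigr => e _; rewrite mulr_sumr.
  by apply: eq_bigr => f _; rewrite mulrCA.
apply: ricci_arith; first by apply: (fd_comm openU).
rewrite -sumrB -big_split -!sumrB; apply: eq_bigr => e _.
by rewrite curvature_frame !(mulrBr, mulrDr).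
Qed.

End Ricci.

(** * The connections of an EAP-space *)

Section Connections.
Variables (R : realType) (n : nat).
Variable U : set ('rV[R]_n * 'rV[R]_n).
Hypothesis openU : open U.
Variable N : 'I_n -> 'I_n -> tpt R n -> R.
Local Notation fd := (fd N).
Local Notation smooth := (@smooth_on R ('rV[R]_n * 'rV[R]_n)%type U).
Hypothesis smooth_N : forall a m, smooth (N a m).
Variable lam : 'I_n -> lvec R n.
Hypothesis smooth_lam : forall l s i, smooth (lam l s i).
Hypothesis free_lam : forall s p, U p -> row_free (lam_mx lam s p).
Implicit Types (p : tpt R n) (W : wcoef R n).
Local Notation can := (canonical_dconn N lam).
Local Notation dual := (dual_dconn N lam).
Local Notation sym := (symmetric_dconn N lam).

Lemma lam_mx_unit s p : U p -> lam_mx lam s p \in unitmx.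
Proof. by move=> Up; rewrite -row_free_unit free_lam. Qed.

(** Invertibility of the [lam] matrix at [p] makes components determined by their contractions with
    all [lam l]; hence identities between W-tensors may be checked on commutators. *)
Lemma sum_lam_inj s p (F G : 'I_n -> R) : U p ->
  (forall l, \sum_e lam l s e p * F e = \sum_e lam l s e p * G e) -> F =1 G.
Proof.
move=> Up FG e.
have : lam_mx lam s p *m (\col_e F e) = lam_mx lam s p *m (\col_e G e).
  apply/matrixP => l z; rewrite !mxE.
  under eq_bigr do rewrite !mxE; rewrite FG.
  by apply: eq_bigr => i _; rewrite !mxE.
move/(congr1 (mulmx (invmx (lam_mx lam s p)))).
by rewrite !mulKmx ?lam_mx_unit // => /matrixP/(_ e 0); rewrite !mxE.
Qed.

Lemma lam_colamE s p l m : U p ->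
  \sum_e lam l s e p * colam lam m s e p = (l == m)%:R.
Proof.
move=> Up; have /matrixP/(_ l m) := mulmxV (lam_mx_unit s Up).
by rewrite !mxE => <-; apply: eq_bigr => e _; rewrite mxE.
Qed.

Lemma colam_lamE s p i j : U p ->
  \sum_l lam l s i p * colam lam l s j p = (i == j)%:R.
Proof.
move=> Up; have /matrixP/(_ j i) := mulVmx (lam_mx_unit s Up).
rewrite !mxE eq_sym => <-; apply: eq_bigr => l _.
by rewrite mxE mulrC.
Qed.

Lemma smooth_colam l s i : smooth (colam lam l s i).
Proof.
apply: (smooth_invmx openU (B := lam_mx lam s)) => [p /(lam_mx_unit s)//|k j].
by apply: smooth_eq_on (smooth_lam k s j) => // q _; rewrite mxE.
Qed.

Lemma smooth_canonical s d i j k : smooth (can s d i j k).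
Proof.
apply: smooth_sum => // l _; apply: smoothM => //.
by apply: fd_smooth => //; exact: smooth_colam.
Qed.

Lemma smooth_symmetric s d i j k : smooth (sym s d i j k).
Proof.
rewrite /symmetric_dconn; case: same_kind; last exact: smooth_canonical.
apply: smoothM => //; first exact: smooth_cst.
by apply: smoothD => //; exact: smooth_canonical.
Qed.

Lemma smooth_dual s d i j k : smooth (dual s d i j k).
Proof. by rewrite /dual_dconn; case: same_kind; exact: smooth_canonical. Qed.

(** Differentiating the constant [\sum_e lam l s e * colam m s e] moves the derivative from [colam]
    to [lam] with a change of sign ([L]). The other inverse relation then turns the connection term
    into [- fd d k (lam l s i)]. *)
Lemma cov_canonical s d l i k p : U p -> cov N can s d (lam l s) i k p = 0.
Proof.
move=> Up; rewrite /cov /canonical_dconn.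
under eq_bigr do rewrite mulr_sumr; rewrite exchange_big /=.
have L m : \sum_e lam l s e p * fd d k (colam lam m s e) p =
           - \sum_e colam lam m s e p * fd d k (lam l s e) p.
  apply/eqP; rewrite -addr_eq0 -big_split.
  rewrite -[X in _ == X](fd_cst N d k (l == m)%:R p).
  have sM e : smooth (fun q => lam l s e q * colam lam m s e q).
    by apply: smoothM => //; exact: smooth_colam.
  have /(fd_eq_on openU N d k)/(_ Up) <- : {in U,
      (fun q => \sum_e lam l s e q * colam lam m s e q) =1 fun=> (l == m)%:R}.
    by move=> q; rewrite inE; exact: lam_colamE.
  rewrite (fd_sum openU) //; apply/eqP/eq_bigr => e _.
  by rewrite (fdM (U := U)) //; exact: smooth_colam.
under eq_bigr do (under eq_bigr do rewrite mulrCA;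
                  rewrite -mulr_sumr L mulrN mulr_sumr).
rewrite sumrN exchange_big /=.
under eq_bigr do (under eq_bigr do rewrite mulrA;
                  rewrite -mulr_suml colam_lamE //).
by rewrite sum_delta1 subrr.
Qed.

Lemma cov_symmetric_mixed s d l i k p : ~~ same_kind s d -> U p ->
  cov N sym s d (lam l s) i k p = 0.
Proof.
move=> sd Up; rewrite -(cov_canonical s d l i k Up) /cov.
by rewrite /symmetric_dconn (negbTE sd).
Qed.

Lemma cov_dual_mixed s d l i k p : ~~ same_kind s d -> U p ->
  cov N dual s d (lam l s) i k p = 0.
Proof.
move=> sd Up; rewrite -(cov_canonical s d l i k Up) /cov.
by rewrite /dual_dconn (negbTE sd).
Qed.

(** With [a] the derivative term and [A], [B] the canonical and dual connection terms, [a + A = 0]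
    gives [a + (A + B)/2 = (a + B)/2]. *)
Lemma cov_symmetric_half s d l i k p : same_kind s d -> U p ->
  cov N sym s d (lam l s) i k p = 2^-1 * cov N dual s d (lam l s) i k p.
Proof.
move=> sd Up; have := cov_canonical s d l i k Up.
rewrite /cov /symmetric_dconn /dual_dconn sd.
under [X in _ -> _ + X = _]eq_bigr do rewrite mulrCA mulrDr.
rewrite -mulr_sumr big_split /=.
move: (fd _ _ _ _) (\sum_e _) (\sum_e _) => a b c ab; lra.
Qed.

Lemma cov_comm_symmetric l s d i j k p : same_kind s d -> U p ->
  cov_comm N sym (lam l) s d d i j k p =
  \sum_e lam l s e p *
    adapted N (curvature N sym (frame N d k) (frame N d j) (frame N s e)) s i p.
Proof.
move=> sd Up; rewrite (ricci_identity openU smooth_N) //; last first.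
  by move=> *; exact: smooth_symmetric.
rewrite [X in _ + X + _]big1 => [|e _]; last first.
  by rewrite /symmetric_dconn; case: d {sd} => /=;
    rewrite [X in _ * (_ - _ * X)]addrC subrr mulr0.
rewrite [X in _ + X]big1 ?addr0 // => m _.
(* The bracket term vanishes for different reasons: in the vertical case the bracket itself is zero,
   in the horizontal case its partner is a mixed covariant derivative. *)
case: s d sd => -[] // _; last by rewrite frame_bracketE !fd_cst subrr mul0r.
by rewrite cov_symmetric_mixed // mulr0.
Qed.

Lemma cov_comm_symmetric_mixed l s d i j k p : ~~ same_kind s d -> U p ->
  cov_comm N sym (lam l) s d d i j k p = 0.
Proof.
move=> sd Up; rewrite /cov_comm !(cov2_eq0 openU) ?subrr // => *.
  exact: cov_symmetric_mixed.
exact: cov_symmetric_mixed.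
Qed.

(** For each [s] one of the two iterated derivatives starts with a mixed one and is zero. In the
    other, the first derivative contributes the factor 1/2 and the second is in the mixed direction,
    where both connections coincide. *)
Lemma cov_comm_symmetric_dual l s i j k p : U p ->
  cov_comm N sym (lam l) s Hor Ver i j k p =
  2^-1 * cov_comm N dual (lam l) s Hor Ver i j k p.
Proof.
move=> Up; have covE d : same_kind s d -> forall i j q, U q ->
    cov N sym s d (lam l s) i j q = 2^-1 * cov N dual s d (lam l s) i j q.
  by move=> sd *; exact: cov_symmetric_half.
have sT d i' j' : smooth (cov N dual s d (lam l s) i' j').
  by apply: cov_smooth => // *; exact: smooth_dual.
rewrite /cov_comm; case: s covE sT => covE sT.
  rewrite [cov2 _ sym Hor Ver _ _ _ _ _ _](cov2_eq0 openU) //; last first.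
    by move=> *; exact: cov_symmetric_mixed.
  rewrite [cov2 _ dual Hor Ver _ _ _ _ _ _](cov2_eq0 openU) //; last first.
    by move=> *; exact: cov_dual_mixed.
  by rewrite !subr0; apply: (cov2Z openU) => //; exact: covE.
rewrite [cov2 _ sym Ver Hor _ _ _ _ _ _](cov2_eq0 openU) //; last first.
  by move=> *; exact: cov_symmetric_mixed.
rewrite [cov2 _ dual Ver Hor _ _ _ _ _ _](cov2_eq0 openU) //; last first.
  by move=> *; exact: cov_dual_mixed.
by rewrite !sub0r mulrN; congr (- _); apply: (cov2Z openU) => //; exact: covE.
Qed.

End Connections.

(** * From the local computation to the charts of an EAP-space *)

Lemma open_tdom (R : realType) (n : nat) (M : topologicalType)
    (A : smoothManifold R n M) (c : chart_index A) :
  open (tdom c : set ('rV[R]_n * 'rV[R]_n)).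
Proof.
apply: (@open_comp ('rV[R]_n * 'rV[R]_n)%type 'rV[R]_n fst (chart c @` dom c)).
  by move=> p _; exact: cvg_fst.
exact: img_open.
Qed.

Lemma smooth_loc_lambda (R : realType) (n : nat) (M : topologicalType)
    (A : smoothManifold R n M) (E : EAP_space A) (c : chart_index A) l s i :
  smooth_on (tdom c) (loc_lambda E c l s i : 'rV[R]_n * 'rV[R]_n -> R).
Proof.
have oU := @open_tdom _ _ _ _ c; case: s; first exact: vcoef_smooth.
apply: smoothD => //; first exact: vcoef_smooth.
apply: smooth_sum => // m _; apply: smoothM => //.
  exact: ncoef_smooth.
exact: vcoef_smooth.
Qed.

Theorem theorem4p4 (R : realType) (n : nat) (M : topologicalType)
    (A : smoothManifold R n M) (E : EAP_space A) (c : chart_index A)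
    (What Wtilde : wcoef R n)
    (hWhat : is_eap_Wtensors E c (eap_symmetric E c) What)
    (hWtilde : is_eap_Wtensors E c (eap_dual E c) Wtilde) :
  forall p : tpt R n, tdom c p ->
  (forall a b nu mu : 'I_n, What Ver Hor Hor a b nu mu p = 0) /\
  (forall al be b c' : 'I_n, What Hor Ver Ver al be b c' p = 0) /\
  (forall al be nu mu : 'I_n,
     What Hor Hor Hor al be nu mu p =
     curvR (loc_N E c) (eap_symmetric E c) al be mu nu p) /\
  (forall al be nu c' : 'I_n,
     What Hor Hor Ver al be nu c' p = 2^-1 * Wtilde Hor Hor Ver al be nu c' p) /\
  (forall a b nu c' : 'I_n,
     What Ver Hor Ver a b nu c' p = 2^-1 * Wtilde Ver Hor Ver a b nu c' p) /\
  (forall a b c' d : 'I_n,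
     What Ver Ver Ver a b c' d p =
     curvS (loc_N E c) (eap_symmetric E c) a b d c' p).

Proof.
move=> p Up; have oU := @open_tdom _ _ _ _ c.
have sN a m : smooth_on (tdom c) (loc_N E c a m : 'rV[R]_n * 'rV[R]_n -> R).
  exact: ncoef_smooth.
have sL := @smooth_loc_lambda _ _ _ _ E c.
have fL s q : tdom c q -> row_free (lam_mx (loc_lambda E c) s q).
  exact: eap_indep.
(* Each claim becomes an equality of contractions with every [lam l], where the defining laws of the
   W-tensors apply. *)
pose inj s F G := @sum_lam_inj _ _ _ _ fL s p F G Up.
split; [|split; [|split; [|split; [|split]]]]; move=> i e j k.
- suff EW : (fun e => What Ver Hor Hor i e j k p) =1 (fun=> 0) by exact: EW.
  apply: (inj Ver) => l; have [<- _ _] := hWhat l Ver i j k p Up.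
  rewrite (cov_comm_symmetric_mixed oU _ sL fL) //.
  by rewrite big1 // => m _; rewrite mulr0.
- suff EW : (fun e => What Hor Ver Ver i e j k p) =1 (fun=> 0) by exact: EW.
  apply: (inj Hor) => l; have [_ _ <-] := hWhat l Hor i j k p Up.
  rewrite (cov_comm_symmetric_mixed oU _ sL fL) //.
  by rewrite big1 // => m _; rewrite mulr0.
- suff EW : (fun e => What Hor Hor Hor i e j k p) =1
        (fun e => curvR (loc_N E c) (eap_symmetric E c) i e k j p) by exact: EW.
  apply: (inj Hor) => l; have [<- _ _] := hWhat l Hor i j k p Up.
  (* The Ricci identity takes the frame directions in the order [k], [j], whence the exchanged last
     indices of the curvature. *)
  exact: (cov_comm_symmetric oU sN sL fL).
- suff EW : (fun e => What Hor Hor Ver i e j k p) =1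
        (fun e => 2^-1 * Wtilde Hor Hor Ver i e j k p) by exact: EW.
  apply: (inj Hor) => l; have [_ <- _] := hWhat l Hor i j k p Up.
  under [RHS]eq_bigr do rewrite mulrCA.
  rewrite -mulr_sumr; have [_ <- _] := hWtilde l Hor i j k p Up.
  exact: (cov_comm_symmetric_dual oU sN sL fL).
- suff EW : (fun e => What Ver Hor Ver i e j k p) =1
        (fun e => 2^-1 * Wtilde Ver Hor Ver i e j k p) by exact: EW.
  apply: (inj Ver) => l; have [_ <- _] := hWhat l Ver i j k p Up.
  under [RHS]eq_bigr do rewrite mulrCA.
  rewrite -mulr_sumr; have [_ <- _] := hWtilde l Ver i j k p Up.
  exact: (cov_comm_symmetric_dual oU sN sL fL).
- suff EW : (fun e => What Ver Ver Ver i e j k p) =1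
        (fun e => curvS (loc_N E c) (eap_symmetric E c) i e k j p) by exact: EW.
  apply: (inj Ver) => l; have [_ _ <-] := hWhat l Ver i j k p Up.
  exact: (cov_comm_symmetric oU sN sL fL).
Qed.
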